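(* Let $d \geq 1$ and let $\alpha \in \mathbb{R}^d$ be an irrational vector. Then any parallelepiped in $\mathbb{R}^d$ spanned by vectors $v_1, \ldots, v_d$ belonging to $\mathbb{Z}\alpha + \mathbb{Z}^d$ is a bounded remainder set (with respect to $\alpha$).
   Context: A vector $\alpha = (\alpha_1,\dots,\alpha_d) \in \mathbb{R}^d$ is called irrational if $1, \alpha_1, \ldots, \alpha_d$ are linearly independent over $\mathbb{Q}$. We write $\mathbb{Z}\alpha+\mathbb{Z}^d = \{ n\alpha + m : n \in \mathbb{Z}, m \in \mathbb{Z}^d\}$ and $\mathbb{T}^d = \mathbb{R}^d/\mathbb{Z}^d$. For a bounded measurable set $S \subset \mathbb{R}^d$ let $\chi_S(x) = \sum_{k \in \mathbb{Z}^d} \mathbf{1}_S(x+k)$, a $\mathbb{Z}^d$-periodic function regarded as a function on $\mathbb{T}^d$. A bounded measurable set $S \subset \mathbb{R}^d$ is a bounded remainder set (BRS) with respect to $\alpha$ if there is a constant $C = C(S,\alpha)$ such that for every $n \geq 1$ and almost every $x \in \mathbb{T}^d$, $\left| \sum_{k=0}^{n-1} \chi_S(x+k\alpha) - n \operatorname{mes} S \right| \leq C$, where $\operatorname{mes}$ is Lebesgue measure. A parallelepiped spanned by vectors $v_1,\dots,v_d$ is a set of the form $\{ \sum_{k=1}^d t_k v_k : 0 \leq t_k < 1 \}$, where $v_1,\dots,v_d$ are linearly independent vectors in $\mathbb{R}^d$. *)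

(* Defs.v *)
From HB Require Import structures.
From mathcomp Require Import all_boot all_order all_algebra.
From mathcomp Require Import all_classical all_reals all_analysis.

Set Implicit Arguments.
Unset Strict Implicit.
Unset Printing Implicit Defensive.

Import Order.TTheory GRing.Theory Num.Theory.
Import numFieldNormedType.Exports.

Local Open Scope classical_set_scope.
Local Open Scope ring_scope.

Section borel_rV.
Context {R : realType} (n : nat).

Definition rV_coord (i : 'I_n) (x : 'rV[R]_n) : measurableTypeR R := x 0 i.

Let rV_set0 : g_sigma_preimage rV_coord set0.
Proof. exact: sigma_algebra0. Qed.

Let rV_setC A : g_sigma_preimage rV_coord A -> g_sigma_preimage rV_coord (~` A).
Proof. exact: sigma_algebraC. Qed.

Let rV_bigcup (F : (set 'rV[R]_n)^nat) :
  (forall i, g_sigma_preimage rV_coord (F i)) ->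
  g_sigma_preimage rV_coord (\bigcup_i F i).
Proof. exact: sigma_algebra_bigcup. Qed.

(* The Borel sigma-algebra of R^n, as the product of the Borel sigma-algebras
   of the coordinates. *)
HB.instance Definition _ :=
  @isMeasurable.Build (measure_tuple_display default_measure_display)
    'rV[R]_n (g_sigma_preimage rV_coord) rV_set0 rV_setC rV_bigcup.

Lemma measurable_rV_coord (i : 'I_n) :
  measurable_fun [set: 'rV[R]_n] (rV_coord i).
Proof.
move=> _ Y mY; rewrite setTI; apply: sub_sigma_algebra => /=.
rewrite -bigcup_seq/=; exists i => /=; first by rewrite mem_index_enum.
by exists Y => //; rewrite setTI.
Qed.

Lemma measurable_fun_rVP d (T : measurableType d) (f : T -> 'rV[R]_n) :
  (forall i, measurable_fun [set: T] (rV_coord i \o f)) ->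
  measurable_fun [set: T] f.
Proof.
move=> mf; have : g_sigma_preimage (fun i => rV_coord i \o f) `<=` measurable.
  apply: smallest_sub; first exact: sigma_algebra_measurable.
  move=> A; rewrite -bigcup_seq => -[i _ [B mB <-]].
  exact: mf.
by rewrite g_sigma_preimage_comp => sf _ A mA; apply: sf; exists A.
Qed.

End borel_rV.

Section lebesgue_rV.
Context {R : realType}.

Definition rV_cons n (p : measurableTypeR R * 'rV[R]_n) : 'rV[R]_n.+1 :=
  row_mx (p.1 : R)%:M p.2 : 'rV[R]_(1 + n).

Lemma rV_cons0 n p : @rV_cons n p 0 ord0 = p.1.
Proof.
have -> : ord0 = lshift n 0 :> 'I_(1 + n) by exact/val_inj.
by apply: (etrans (row_mxEl (p.1 : R)%:M p.2 0 0)); rewrite mxE mulr1n.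
Qed.

Lemma rV_consS n p i : @rV_cons n p 0 (lift ord0 i) = p.2 0 i.
Proof.
have -> : lift ord0 i = rshift 1 i :> 'I_(1 + n) by exact/val_inj.
exact: (row_mxEr (p.1 : R)%:M p.2 0 i).
Qed.

Lemma measurable_rV_cons n : measurable_fun setT (@rV_cons n).
Proof.
apply: measurable_fun_rVP => i.
case: (unliftP ord0 i) => [j|] ->; last first.
  rewrite (_ : _ \o _ = fst) //.
  by apply/funext => p; rewrite /= /rV_coord rV_cons0.
rewrite (_ : _ \o _ = rV_coord j \o snd).
  by apply: measurableT_comp => //; exact: measurable_rV_coord.
by apply/funext => p; rewrite /= /rV_coord rV_consS.
Qed.

Definition rV_uncons n (x : 'rV[R]_n.+1) : measurableTypeR R * 'rV[R]_n :=
  ((lsubmx (x : 'rV[R]_(1 + n))) 0 0, rsubmx (x : 'rV[R]_(1 + n))).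

Lemma rV_unconsK n : cancel (@rV_uncons n) (@rV_cons n).
Proof. by move=> x; rewrite /rV_cons /= -mx11_scalar hsubmxK. Qed.

Lemma rV_consK n : cancel (@rV_cons n) (@rV_uncons n).
Proof.
by move=> [a x]; rewrite /rV_cons /rV_uncons row_mxKl row_mxKr mxE mulr1n.
Qed.

Lemma measurable_rV_uncons n : measurable_fun setT (@rV_uncons n).
Proof.
apply: measurable_fun_pair.
  rewrite (_ : (fun _ => _) = rV_coord (lshift n 0 : 'I_(1 + n))).
    exact: measurable_rV_coord.
  by apply/funext => x; rewrite /rV_coord mxE.
apply: measurable_fun_rVP => i.
rewrite (_ : _ \o _ = rV_coord (rshift 1 i)); first exact: measurable_rV_coord.
by apply/funext => x; rewrite /rV_coord /= mxE.
Qed.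

Section step.
Context (n : nat).
Variable mu : {sigma_finite_measure set 'rV[R]_n -> \bar R}.

Definition lebesgue_rVS : set 'rV[R]_n.+1 -> \bar R :=
  pushforward (lebesgue_measure \x mu)%E (@rV_cons n).

Let lebesgue_rVS0 : lebesgue_rVS set0 = 0%E.
Proof. by rewrite /lebesgue_rVS /pushforward preimage_set0 measure0. Qed.

Let lebesgue_rVS_ge0 A : (0 <= lebesgue_rVS A)%E.
Proof. exact: (measure_ge0 (lebesgue_measure \x mu)%E). Qed.

Let lebesgue_rVS_sigma_additive : semi_sigma_additive lebesgue_rVS.
Proof. apply: measure_semi_sigma_additive; exact: measurable_rV_cons. Qed.

HB.instance Definition _ := isMeasure.Build _ _ _ lebesgue_rVS
  lebesgue_rVS0 lebesgue_rVS_ge0 lebesgue_rVS_sigma_additive.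

Let lebesgue_rVS_sigma_finite : sigma_finite setT lebesgue_rVS.
Proof.
have /sigma_finiteP[F [TF ndF Foo]] := sigma_finiteT (@lebesgue_measure R).
have /sigma_finiteP[G [TG ndG Goo]] := sigma_finiteT mu.
exists (fun k => @rV_uncons n @^-1` (F k `*` G k)).
  apply/esym; rewrite -subTset => x _.
  have [i _ Fa] : (\bigcup_i F i) (rV_uncons x).1 by rewrite -TF.
  have [j _ Gy] : (\bigcup_j G j) (rV_uncons x).2 by rewrite -TG.
  exists (maxn i j) => //; split.
    by move: Fa; exact/subsetPset/ndF/leq_maxl.
  by move: Gy; exact/subsetPset/ndG/leq_maxr.
move=> k; have [mF Fk] := Foo k; have [mG Gk] := Goo k; split.
  rewrite -[X in measurable X]setTI; apply: measurable_rV_uncons => //.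
  exact: measurableX.
rewrite /lebesgue_rVS /pushforward (_ : _ @^-1` _ = F k `*` G k).
  by rewrite product_measure1E// lte_mul_pinfty// ge0_fin_numE.
rewrite -comp_preimage (_ : _ \o _ = id) ?preimage_id//.
by apply/funext => x; exact: rV_consK.
Qed.

HB.instance Definition _ := Measure_isSigmaFinite.Build _ _ _
  lebesgue_rVS lebesgue_rVS_sigma_finite.

End step.

(* Lebesgue measure on the Borel sets of R^n, as an n-fold product. *)
Fixpoint lebesgue_rV n : {sigma_finite_measure set 'rV[R]_n -> \bar R} :=
  match n with
  | 0 => \d_(0 : 'rV[R]_0)
  | n'.+1 => lebesgue_rVS (lebesgue_rV n')
  end.

Lemma lebesgue_rV_box n (A : 'I_n -> set (measurableTypeR R)) :
  (forall i, measurable (A i)) ->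
  lebesgue_rV n [set x | forall i, A i (x 0 i)] =
    (\prod_(i < n) lebesgue_measure (A i))%E.
Proof.
elim: n A => [|n IHn] A mA.
  by rewrite big_ord0 /= diracE mem_set// => -[].
rewrite big_ord_recl -IHn; last by move=> i; exact: mA.
have mB : measurable [set x : 'rV[R]_n | forall i, A (lift ord0 i) (x 0 i)].
  rewrite (_ : mkset _ = \bigcap_(i in [set: 'I_n])
      (rV_coord i @^-1` A (lift ord0 i))).
    apply: fin_bigcap_measurable => // i _; rewrite -[X in measurable X]setTI.
    exact: measurable_rV_coord.
  by apply/seteqP; split=> [x Ax i _|x Ax i]; [exact: Ax|exact: (Ax i)].
rewrite /= /lebesgue_rVS /pushforward -product_measure1E//; congr (_ _).
apply/seteqP; split=> -[a y] /= Aay.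
  split; first by have := Aay ord0; rewrite rV_cons0.
  by move=> i; have := Aay (lift ord0 i); rewrite rV_consS.
move=> i; case: (unliftP ord0 i) => [j|] ->; last by rewrite rV_cons0; case: Aay.
by rewrite rV_consS; case: Aay => _.
Qed.

End lebesgue_rV.

Definition lebesgue_measurable (R : realType) d (S : set 'rV[R]_d) : Prop :=
  ((lebesgue_rV d)^*)%mu.-cara.-measurable S.

(* Lebesgue measure on the Lebesgue-measurable subsets of R^d. *)
Definition mes (R : realType) d :=
  @completed_measure_extension _ _ R (@lebesgue_rV R d).
Arguments mes {R} d.

Section bounded_remainder_sets.
Context {R : realType}.

Definition irrational_vec d (alpha : 'rV[R]_d) : Prop :=
  forall (q0 : rat) (q : 'I_d -> rat),
    ratr q0 * 1 + \sum_(i < d) ratr (q i) * alpha 0 i = 0 ->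
    q0 = 0 /\ forall i, q i = 0.

Definition int_vec d (m : 'rV[int]_d) : 'rV[R]_d := map_mx intr m.

Definition Zalpha_plus_Zd d (alpha : 'rV[R]_d) : set 'rV[R]_d :=
  [set v | exists (n : int) (m : 'rV[int]_d), v = n%:~R *: alpha + int_vec m].

(* Only meant for bounded S, when the sum has finitely many nonzero terms;
   by convention a sum with infinitely many nonzero terms is 0. *)
Definition chi d (S : set 'rV[R]_d) (x : 'rV[R]_d) : R :=
  \sum_(k \in [set: 'rV[int]_d]) (\1_S (x + int_vec k) : R).

(* The quantity bounded below is Z^d-periodic in x, and a subset of the torus
   R^d / Z^d is null iff its inverse image in R^d is Lebesgue null, so "almost
   every x" ranges over R^d.  [fine] is harmless as a bounded set has finite
   measure. *)
Definition bounded_remainder_set d (alpha : 'rV[R]_d) (S : set 'rV[R]_d) :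
    Prop :=
  [/\ bounded_set S, lebesgue_measurable S &
    exists C : R, forall n : nat, (1 <= n)%N ->
      {ae mes d, forall x : 'rV[R]_d,
        `| \sum_(0 <= k < n) chi S (x + k%:R *: alpha)
           - n%:R * fine (mes d S) | <= C }].

Definition parallelepiped d (v : d.-tuple 'rV[R]_d) : set 'rV[R]_d :=
  [set x | exists t : 'I_d -> R, (forall k, 0 <= t k < 1) /\
    x = \sum_(k < d) t k *: tnth v k].

End bounded_remainder_sets.

(* Main.v *)
Require Import Defs.
From HB Require Import structures.
From mathcomp Require Import all_boot all_order all_algebra.
From mathcomp Require Import all_classical all_reals all_analysis.
From mathcomp Require Import finmap measurable_realfun zify ring lra.

Set Implicit Arguments.
Unset Strict Implicit.
Unset Printing Implicit Defensive.

Import Order.TTheory GRing.Theory Num.Theory.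
Import numFieldNormedType.Exports.

Local Open Scope classical_set_scope.
Local Open Scope ring_scope.

(** Write v_k = p_k alpha + q_k with p_k an integer and q_k an integer vector,
    let S be the parallelepiped, F_n(x) = sum_(0 <= k < n) chi_S(x + k alpha).
    Then F_n(x) counts the pairs (k, m) with 0 <= k < n and
    x + k alpha + m in S.

    The vectors (p_k, q_k) generate a subgroup L of Z^(1+d).  Since S is a
    fundamental domain of the lattice generated by the v_k, for every x each
    coset of L contains exactly one pair (k, m), with k of any sign, such that
    x + k alpha + m lies in S: reduce the coordinates of x + k alpha + m in the
    basis v modulo 1 ([reduce]).  Hence for any x and y there is a bijection
    between the pairs that hit S from x and those that hit it from y.  When x
    and y are in the unit cube, the coordinates of x and y in the basis v are
    bounded, so this bijection changes k by at most some D that depends neither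
    on x, y nor on n ([reduce_displacement]).  Up to the at most 2 D times near
    the ends of [0, n), where chi_S is bounded, F_n(x) is thus at most F_n(y)
    ([visits_compare]), and F_n oscillates by at most a constant C
    ([birkhoff_oscillation]).

    Finally the average of F_n over the unit cube is n mes S ([integral_chi],
    [integral_birkhoff]): the translates of the cube by integer vectors cut S
    into pieces, and Lebesgue measure is translation invariant.  A function that
    oscillates by at most C is within C of its average, which bounds
    F_n(x) - n mes S for x in the cube, and everywhere by periodicity. *)

(** * Translation invariance of Lebesgue measure on R^n *)

Section translation.
Context {R : realType}.

Lemma measurable_addr (a : R) :
  measurable_fun setT (+%R^~ a : measurableTypeR R -> measurableTypeR R).
Proof. by apply: (@measurable_funD _ (measurableTypeR R) R _ id (cst a)). Qed.

(** A measure on R that agrees with Lebesgue measure on half-open intervals is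
    Lebesgue measure; the image of Lebesgue measure by a translation does. *)
Lemma lebesgue_measure_addr (a : R) (A : set (measurableTypeR R)) :
  measurable A -> lebesgue_measure (+%R^~ a @^-1` A) = lebesgue_measure A.
Proof.
move=> mA; apply/esym.
pose nu := measure_function_pushforward__canonical__measure_function_Measure
  (@lebesgue_measure R) (measurable_addr a).
apply: (@lebesgue_measure_unique R nu) => // X [[u w] _ <-] /=.
rewrite /pushforward.
rewrite [X in _ = lebesgue_measure X](_ : _ = `]u - a, w - a]%classic).
  rewrite !lebesgue_measure_itv /= !lte_fin ltrD2r.
  by case: ifP => //; rewrite -!EFinB opprB addrA subrK.
by apply/seteqP; split=> x /=; rewrite !in_itv /= ltrBlDr lerBrDr.
Qed.

Lemma measurable_rV_addr n (z : 'rV[R]_n) :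
  measurable_fun setT (+%R^~ z : 'rV[R]_n -> 'rV[R]_n).
Proof.
apply: measurable_fun_rVP => i.
rewrite (_ : _ \o _ = +%R^~ (z 0 i) \o rV_coord i); last first.
  by apply/funext => x; rewrite /= /rV_coord mxE.
apply: measurableT_comp; first exact: measurable_addr.
exact: measurable_rV_coord.
Qed.

Lemma measurable_rV_addr_preimage n (z : 'rV[R]_n) (S : set 'rV[R]_n) :
  measurable S -> measurable (+%R^~ z @^-1` S).
Proof.
by move=> mS; rewrite -[X in measurable X]setTI; exact: measurable_rV_addr.
Qed.

(** By induction on the dimension: the image of a product measure by a
    translation agrees with the product measure on rectangles, hence equals
    it. *)
Lemma lebesgue_rV_addr n (z : 'rV[R]_n) (A : set 'rV[R]_n) :
  measurable A -> lebesgue_rV n (+%R^~ z @^-1` A) = lebesgue_rV n A.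
Proof.
elim: n z A => [|n IHn] z A mA.
  by congr (lebesgue_rV 0 _); apply/funext => x /=; congr A; apply/rowP => -[].
set t := fun p : measurableTypeR R * 'rV[R]_n =>
  (p.1 + z 0 ord0 : measurableTypeR R, p.2 + \row_i z 0 (lift ord0 i)).
have mt : measurable_fun setT t.
  apply: measurable_fun_pair.
    by apply: (measurableT_comp (measurable_addr _)).
  by apply: (measurableT_comp (measurable_rV_addr _)).
have tE p : rV_cons p + z = rV_cons (t p).
  apply/rowP => i; rewrite mxE.
  by case: (unliftP ord0 i) => [j|] ->; rewrite ?rV_consS ?rV_cons0 //= !mxE.
rewrite /= /lebesgue_rVS /pushforward.
rewrite -comp_preimage (_ : _ \o _ = @rV_cons R n \o t); last exact/funext.
rewrite comp_preimage; apply/esym.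
pose nu := measure_function_pushforward__canonical__measure_function_Measure
  (lebesgue_measure \x lebesgue_rV n)%E mt.
apply: (@product_measure_unique _ _ _ _ _ _ _ nu) => [B C mB mC|].
  rewrite /= /pushforward.
  rewrite (_ : _ @^-1` _ = (+%R^~ (z 0 ord0) @^-1` B) `*`
    (+%R^~ (\row_i z 0 (lift ord0 i)) @^-1` C)) //.
  have mB' : measurable (+%R^~ (z 0 ord0) @^-1` B : set (measurableTypeR R)).
    by rewrite -[X in measurable X]setTI; exact: measurable_addr.
  have mC' : measurable (+%R^~ (\row_i z 0 (lift ord0 i)) @^-1` C).
    exact: measurable_rV_addr_preimage.
  rewrite product_measure1E //.
  by congr (_ * _)%E; [exact: lebesgue_measure_addr|exact: IHn].
by rewrite -[X in measurable X]setTI; exact: measurable_rV_cons.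
Qed.

End translation.

(** * Periodization and its average over the unit cube *)

Section periodization.
Context {R : realType} (d : nat).
Implicit Types (S : set 'rV[R]_d) (x z : 'rV[R]_d).

Definition unit_cube : set 'rV[R]_d := [set x | forall i, 0 <= x 0 i < 1].

Definition coord_bounded S :=
  exists K : R, forall x, S x -> forall i, `|x 0 i| <= K.

Definition hits S x : set 'rV[int]_d := [set m | S (x + int_vec m)].

Lemma int_vecD (k m : 'rV[int]_d) :
  int_vec (k + m) = int_vec k + int_vec m :> 'rV[R]_d.
Proof. exact: map_mxD. Qed.

Lemma unit_cube_representative x :
  exists2 y, unit_cube y & exists m : 'rV[int]_d, x = y + int_vec m.
Proof.
exists (x - int_vec (\row_i Num.floor (x 0 i))).
  by move=> i; rewrite !mxE subr_ge0 ltrBlDl -intrD1 ge_floor floorD1_gt.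
by exists (\row_i Num.floor (x 0 i)); rewrite subrK.
Qed.

Lemma finite_int_box (K : R) :
  finite_set [set m : 'rV[int]_d | forall i, `|(m 0 i)%:~R| <= K].
Proof.
have [N KN] : exists N : nat, K <= N%:R.
  by exists (Num.trunc K).+1; exact/ltW/truncnS_gt.
pose f (u : 'rV['I_(N + N).+1]_d) : 'rV[int]_d :=
  map_mx (fun o : 'I__ => o%:Z - N%:Z) u.
apply: (@sub_finite_set _ _ (f @` setT)); last exact: finite_image.
move=> m /= mK; exists (\row_i inord `|m 0 i + N%:Z|) => //.
apply/rowP => i; rewrite !mxE.
have mN : (`|m 0 i| <= N%:Z)%R.
  by rewrite -(ler_int R) intr_norm (le_trans (mK i)).
by rewrite inordK; lia.
Qed.

(** The finiteness is uniform over the x of the unit cube, so that chi S is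
    there a single finite sum of indicators. *)
Lemma finite_hits S z : coord_bounded S ->
  finite_set [set m : 'rV[int]_d |
    exists2 x, unit_cube x & S (x + z + int_vec m)].
Proof.
move=> [K SK].
apply: sub_finite_set (finite_int_box (K + 1 + \sum_i `|z 0 i|)).
move=> m /= [x Qx /SK xK] i; have := xK i; rewrite !mxE => xKi.
have zi : `|z 0 i| <= \sum_i `|z 0 i|.
  by rewrite (bigD1 i) //= lerDl sumr_ge0.
by have := Qx i; move: xKi zi; rewrite !ler_norml; lra.
Qed.

Lemma chi_periodic S x (m : 'rV[int]_d) : chi S (x + int_vec m) = chi S x.
Proof.
rewrite /chi [RHS](reindex_fsbigT (+%R m)); last first.
  by exists (+%R (- m)) => k; rewrite ?addKr ?addNKr.
by apply: eq_fsbigr => k _; rewrite int_vecD addrA.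
Qed.

Lemma chi_sum S x (M : set 'rV[int]_d) : finite_set M ->
  (forall m, S (x + int_vec m) -> M m) ->
  chi S x = \sum_(m \in M) (\1_S (x + int_vec m) : R).
Proof.
move=> finM SM; rewrite /chi [RHS](fsbig_widen M setT) // => m [_ /= nMm].
by rewrite indicE memNset // => /SM.
Qed.

Lemma chi_card S x : finite_set (hits S x) ->
  chi S x = (#|` fset_set (hits S x)|%fset)%:R.
Proof.
move=> fin; rewrite (chi_sum fin) // fsbig_finite //= big_seq.
rewrite (eq_bigr (fun=> 1)) => [|m]; last first.
  by rewrite in_fset_set // => /set_mem Sm; rewrite indicE mem_set.
by rewrite -big_seq big_const_seq count_predT iter_addr_0.
Qed.

Lemma finite_orbit_hits S x : coord_bounded S ->
  finite_set (hits S x).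
Proof.
move=> bS; apply: sub_finite_set (finite_hits x bS) => m /= Sm.
by exists 0; rewrite ?add0r // => i; rewrite mxE lexx ltr01.
Qed.

Lemma chi_ge0 S x : 0 <= chi S x.
Proof. by apply: fsumr_ge0 => m _; rewrite indicE. Qed.

Lemma chi_bounded S : coord_bounded S -> exists M : R, forall x, chi S x <= M.
Proof.
move=> bS; have fin := finite_hits 0 bS.
set H := [set m | _] in fin; exists (#|` fset_set H|%fset)%:R => x.
have [y Qy [m ->]] := unit_cube_representative x.
rewrite chi_periodic chi_card; last exact: finite_orbit_hits.
rewrite ler_nat fsubset_leq_card // -fset_set_sub //; last first.
  exact: finite_orbit_hits.
by move=> k /= Sk; exists y => //; rewrite addr0.
Qed.

Lemma measurable_unit_cube : measurable unit_cube.
Proof.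
rewrite (_ : unit_cube = \bigcap_(i in [set: 'I_d]) (rV_coord i @^-1` `[0, 1[)).
  apply: fin_bigcap_measurable => // i _; rewrite -[X in measurable X]setTI.
  exact: measurable_rV_coord.
apply/seteqP; split=> [x Qx i _|x Qx i] /=; first by rewrite in_itv; exact: Qx.
by have := Qx i I; rewrite /= in_itv.
Qed.

Lemma lebesgue_unit_cube : lebesgue_rV d unit_cube = 1%E.
Proof.
pose I01 (i : 'I_d) : set (measurableTypeR R) := `[0, 1[%classic.
have -> : unit_cube = [set x | forall i, I01 i (x 0 i)].
  by apply/seteqP; split=> x Qx i; have := Qx i; rewrite /I01 /= in_itv.
rewrite lebesgue_rV_box => [|i]; last exact: measurable_itv.
rewrite big1 // => i _.
by rewrite lebesgue_measure_itv /= lte_fin ltr01 oppr0 adde0.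
Qed.

Lemma measurable_chi_translate S z : coord_bounded S -> measurable S ->
  measurable_fun unit_cube (fun x => chi S (x + z)).
Proof.
move=> bS mS; have fin := finite_hits z bS; set H := [set m | _] in fin.
have mI m : measurable_fun unit_cube
    (\1_(+%R^~ (z + int_vec m) @^-1` S) : 'rV[R]_d -> R).
  by apply: measurable_indic; exact: measurable_rV_addr_preimage.
apply: eq_measurable_fun (measurable_sum (fset_set H) mI) => x /set_mem Qx.
rewrite (chi_sum fin) => [|m Sm]; last by exists x.
rewrite fsbig_finite //; apply: eq_bigr => m _.
by rewrite -addrA !indicE.
Qed.

(** Unfolding: the translates of the unit cube by integer vectors partition R^d,
    and the part of S in the translate by z + m has the measure of the part of
    S - z - m in the cube. *)
Lemma integral_chi S z : coord_bounded S -> measurable S ->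
  (\int[lebesgue_rV d]_(x in unit_cube) (chi S (x + z))%:E =
   lebesgue_rV d S)%E.
Proof.
move=> bS mS; have fin := finite_hits z bS; set H := [set m | _] in fin.
pose A (m : 'rV[int]_d) := +%R^~ (z + int_vec m) @^-1` S.
have mA m : measurable (A m) by exact: measurable_rV_addr_preimage.
transitivity (\int[lebesgue_rV d]_(x in unit_cube)
    \sum_(m \in H) (\1_(A m) x : R)%:E)%E.
  apply: eq_integral => x /set_mem Qx.
  rewrite (chi_sum fin) => [|m Sm]; last by exists x.
  rewrite -fsumEFin //; apply: eq_fsbigr => m _.
  by rewrite -addrA !indicE.
rewrite ge0_integral_fsum //; last 2 first.
- exact: measurable_unit_cube.
- by move=> m; apply/measurable_EFinP; exact: measurable_indic.
pose B (m : 'rV[int]_d) :=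
  S `&` (+%R^~ (- (z + int_vec m)) @^-1` unit_cube).
have mB m : measurable (B m).
  apply: measurableI => //; apply: measurable_rV_addr_preimage.
  exact: measurable_unit_cube.
transitivity (\sum_(m \in H) lebesgue_rV d (B m))%E.
  apply: eq_fsbigr => m _; rewrite integral_indic //; last first.
    exact: measurable_unit_cube.
  rewrite -[RHS](lebesgue_rV_addr (z + int_vec m)).
    rewrite preimage_setI; congr (lebesgue_rV d (_ `&` _)).
    by apply/funext => x; rewrite /preimage /= addrK.
  exact: mB.
rewrite -measure_fin_bigcup //.
- (* The cubes that meet S are exactly those indexed by H, so they cover S. *)
  congr (lebesgue_rV d _); apply/seteqP; split=> [x [m _ []] //|x Sx].
  have [y Qy [m xE]] := unit_cube_representative (x - z).
  have xE' : x = y + z + int_vec m by rewrite addrAC -xE subrK.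
  exists m; first by exists y => //; rewrite -xE'.
  by split=> //=; rewrite xE' -(addrA y) addrK.
- (* Integers less than 1 apart are equal, so distinct cubes are disjoint. *)
  move=> m k _ _ [x [[_ Qm] [_ Qk]]]; apply/rowP => i.
  have := Qm i; have := Qk i; rewrite !mxE => a b.
  have : (m 0 i - k 0 i)%:~R < (1%:~R : R) by rewrite intrB; lra.
  have : ((- 1)%:~R : R) < (m 0 i - k 0 i)%:~R by rewrite intrB; lra.
  by rewrite !ltr_int; lia.
Qed.

End periodization.
Arguments unit_cube {R d}.

Section averaging.
Context {R : realType} (d : nat).

Lemma integral_unit_cube_cst (c : R) :
  (\int[lebesgue_rV d]_(x in @unit_cube R d) c%:E = c%:E)%E.
Proof.
rewrite (integral_cst _ (@measurable_unit_cube R d)) -[RHS]mule1.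
by congr (_ * _)%E; exact: lebesgue_unit_cube.
Qed.

(** Averaging turns a bound on the oscillation of f into a bound on its distance
    to its mean, as the unit cube has measure 1. *)
Lemma dist_average_le (f : 'rV[R]_d -> R) (I u C : R) :
  measurable_fun unit_cube f -> (forall x, 0 <= f x) ->
  (\int[lebesgue_rV d]_(x in unit_cube) (f x)%:E = I%:E)%E ->
  (forall x, unit_cube x -> `|u - f x| <= C) -> `|u - I| <= C.
Proof.
move=> mf f0 fI uf; have mQ := @measurable_unit_cube R d.
have mfE : measurable_fun unit_cube (EFin \o f) by exact/measurable_EFinP.
have I0 : 0 <= I.
  by rewrite -lee_fin -fI integral_ge0 // => x _; rewrite lee_fin.
have Qb x : unit_cube x -> u - C <= f x <= u + C.
  by move=> /uf; rewrite ler_norml; lra.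
have ub : I <= u + C.
  rewrite -lee_fin -fI -(integral_unit_cube_cst (u + C)) ge0_le_integral //.
  - by move=> x _; rewrite lee_fin.
  - by move=> x /Qb; rewrite lee_fin; case/andP.
have lb : u - C <= I.
  (* Monotonicity applies to nonnegative functions only. *)
  have [uC|uC] := leP 0 (u - C); last exact: le_trans (ltW uC) I0.
  rewrite -lee_fin -fI -(integral_unit_cube_cst (u - C)) ge0_le_integral //.
  - by move=> x /Qb; rewrite lee_fin; case/andP.
rewrite ler_norml; lra.
Qed.

Lemma lebesgue_rV_fin_num (S : set 'rV[R]_d) :
  coord_bounded S -> measurable S -> lebesgue_rV d S \is a fin_num.
Proof.
move=> bS mS; have [M hM] := chi_bounded bS.
have mQ := @measurable_unit_cube R d.
rewrite ge0_fin_numE // -(integral_chi 0 bS mS).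
apply: (@le_lt_trans _ _ (\int[lebesgue_rV d]_(x in unit_cube) M%:E)%E).
  apply: ge0_le_integral => //.
  - by move=> x _; rewrite lee_fin chi_ge0.
  - by apply/measurable_EFinP; exact: measurable_chi_translate.
  - by move=> x _; rewrite lee_fin.
by rewrite integral_unit_cube_cst ltry.
Qed.

Lemma mesE (S : set 'rV[R]_d) : measurable S -> mes d S = lebesgue_rV d S.
Proof. exact: measurable_mu_extE. Qed.

Lemma measurable_lebesgue_measurable (S : set 'rV[R]_d) :
  measurable S -> lebesgue_measurable S.
Proof. by move=> mS; apply: sub_caratheodory; exact: sub_sigma_algebra. Qed.

End averaging.

(** * Parallelepipeds in the coordinates of their edges *)

Section coordinates.
Context {R : realType} (d : nat) (v : d.-tuple 'rV[R]_d).
Hypothesis hfree : free v.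

Lemma coord_free_sum x : \sum_(k < d) coord v k x *: tnth v k = x.
Proof.
have vb : basis_of fullv v.
  by rewrite basisEfree hfree subvf size_tuple dimvf /= /dim /= mul1n leqnn.
rewrite [RHS](coord_basis vb (memvf x)).
by apply: eq_bigr => k _; rewrite (tnth_nth 0).
Qed.

Lemma coord_lin_comb (a : 'I_d -> R) k :
  coord v k (\sum_(j < d) a j *: tnth v j) = a k.
Proof.
rewrite (eq_bigr (fun j => a j *: v`_j)) => [|j _]; first exact: coord_sum_free.
by rewrite (tnth_nth 0).
Qed.

Lemma parallelepipedP x :
  parallelepiped v x <-> forall k, 0 <= coord v k x < 1.
Proof.
split=> [[t [t01 ->]] k|x01].
  by rewrite coord_lin_comb.
by exists (fun k => coord v k x); rewrite coord_free_sum.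
Qed.

Lemma coord_unit_cube k x : unit_cube x ->
  `|coord v k x| <= \sum_i `|coord v k (delta_mx 0 i)|.
Proof.
move=> Qx; rewrite [x in coord v k x]row_sum_delta linear_sum.
apply: (le_trans (ler_norm_sum _ _ _)); apply: ler_sum => i _.
rewrite linearZ /= normrM ler_piMl //; have := Qx i.
by rewrite ler_norml; lra.
Qed.

Lemma measurable_parallelepiped : measurable (parallelepiped v).
Proof.
pose c k (x : 'rV[R]_d) : measurableTypeR R := coord v k x.
rewrite (_ : parallelepiped v = \bigcap_(k in [set: 'I_d]) (c k @^-1` `[0, 1[));
    last first.
  apply/seteqP; split=> [x /parallelepipedP vx k _|x vx].
    by rewrite /= in_itv; exact: vx.
  by apply/parallelepipedP => k; have := vx k I; rewrite /= in_itv.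
apply: fin_bigcap_measurable => // k _; rewrite -[X in measurable X]setTI.
have mc : measurable_fun setT (c k).
  rewrite (_ : c k = (fun x : 'rV[R]_d =>
      \sum_i coord v k (delta_mx 0 i) * rV_coord i x)).
    apply: measurable_sum => i; apply: measurable_funM => //.
    exact: measurable_rV_coord.
  apply/funext => x; rewrite /c [x in LHS]row_sum_delta linear_sum.
  by apply: eq_bigr => i _; rewrite linearZ /= mulrC.
exact: mc.
Qed.

Lemma coord_bounded_parallelepiped : coord_bounded (parallelepiped v).
Proof.
exists (\sum_i \sum_k `|tnth v k 0 i|) => x [t [t01 ->]] i.
rewrite summxE; apply: (le_trans (ler_norm_sum _ _ _)).
rewrite [leRHS](bigD1 i) //= ler_wpDr ?sumr_ge0 // => [j _|].
  exact: sumr_ge0.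
apply: ler_sum => k _; rewrite mxE normrM ler_piMl //.
by have := t01 k; rewrite ler_norml; lra.
Qed.

Lemma bounded_parallelepiped : bounded_set (parallelepiped v).
Proof.
exists (\sum_k `|tnth v k|); split=> [|M BM x [t [t01 ->]]].
  exact: num_real.
apply: le_trans (ltW BM); apply: (le_trans (ler_norm_sum _ _ _)).
apply: ler_sum => k _.
rewrite normrZ ler_piMl //; have := t01 k; rewrite ler_norml; lra.
Qed.

End coordinates.

(** * Counting the visits of an orbit modulo integer vectors *)

Section orbit_counting.
Context {R : realType} (d : nat) (alpha : 'rV[R]_d).
Implicit Types (S : set 'rV[R]_d) (x y : 'rV[R]_d).

Definition orbit_point x (km : int * 'rV[int]_d) : 'rV[R]_d :=
  x + km.1%:~R *: alpha + int_vec km.2.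

Definition visits S x a b : seq (nat * 'rV[int]_d) :=
  [seq (k, m) | k <- index_iota a b,
                m <- fset_set (hits S (x + k%:R *: alpha))].

Lemma visits_uniq S x a b : uniq (visits S x a b).
Proof.
apply: allpairs_uniq_dep => [|k _|]; [exact: iota_uniq|exact: fset_uniq|].
by move=> [k m] [k' m'] _ _ [-> ->].
Qed.

Lemma mem_visits S x a b k m : coord_bounded S ->
  (k, m) \in visits S x a b <->
  (a <= k < b)%N /\ S (orbit_point x (k%:Z, m)).
Proof.
move=> bS; have fin k' := finite_orbit_hits (x + k'%:R *: alpha) bS; split.
  case/allpairsPdep => k' [m' [kab mS [-> ->]]].
  by move: kab mS; rewrite mem_index_iota in_fset_set // => ? /set_mem.
move=> [kab Sm]; apply/allpairsPdep; exists k, m; split => //.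
  by rewrite mem_index_iota.
by rewrite in_fset_set //; exact/mem_set.
Qed.

Lemma sum_chi_visits S x a b : coord_bounded S ->
  \sum_(a <= k < b) chi S (x + k%:R *: alpha) = (size (visits S x a b))%:R.
Proof.
move=> bS; rewrite size_allpairs_dep sumnE big_map natr_sum.
by apply: eq_bigr => k _; rewrite chi_card //; exact: finite_orbit_hits.
Qed.

End orbit_counting.

(** * Cosets of the lattice of return times *)

Section reduction.
Context {R : realType} (d : nat) (alpha : 'rV[R]_d) (v : d.-tuple 'rV[R]_d).
Hypothesis hfree : free v.
Variables (p : 'I_d -> int) (q : 'I_d -> 'rV[int]_d).
Hypothesis hv : forall k, tnth v k = (p k)%:~R *: alpha + int_vec (q k).
Implicit Types (x y : 'rV[R]_d).

Local Notation orbit_point := (orbit_point alpha).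

Let quot y km k : int := Num.floor (coord v k (orbit_point y km)).

(** The representative of the coset of (k, m) modulo the group generated by the
    (p_k, q_k) whose orbit point from y has coordinates in [0, 1). *)
Definition reduce y (km : int * 'rV[int]_d) : int * 'rV[int]_d :=
  (km.1 - \sum_k quot y km k * p k, km.2 - \sum_k quot y km k *: q k).

Lemma int_vec_sum (F : 'I_d -> 'rV[int]_d) :
  int_vec (\sum_k F k) = \sum_k int_vec (F k) :> 'rV[R]_d.
Proof.
apply/rowP => i; rewrite mxE !summxE rmorph_sum /=.
by apply: eq_bigr => k _; rewrite mxE.
Qed.

(** Moving along the group generated by the (p_k, q_k) moves the orbit point
    along the lattice generated by the v_k. *)
Lemma orbit_point_lattice x km (a : 'I_d -> int) :
  orbit_point x (km.1 - \sum_k a k * p k, km.2 - \sum_k a k *: q k) =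
  orbit_point x km - \sum_k (a k)%:~R *: tnth v k.
Proof.
rewrite /orbit_point /= intrB scalerBl -!addrA; congr (_ + (_ + _)).
have -> : \sum_k (a k)%:~R *: tnth v k =
  (\sum_k a k * p k)%:~R *: alpha + int_vec (\sum_k a k *: q k).
  rewrite int_vec_sum rmorph_sum /= scaler_suml -big_split /=.
  apply: eq_bigr => k _; rewrite hv scalerDr scalerA intrM; congr (_ + _).
  by apply/rowP => i; rewrite !mxE intrM.
rewrite opprD addrCA; congr (_ + _).
by apply/rowP => i; rewrite !mxE intrB.
Qed.

Lemma reduce_hits y km : parallelepiped v (orbit_point y (reduce y km)).
Proof.
apply/(parallelepipedP hfree) => k; rewrite orbit_point_lattice linearB /=.
by rewrite coord_lin_comb // subr_ge0 ltrBlDl -intrD1 ge_floor floorD1_gt.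
Qed.

(** If two pairs have the same reduction, their orbit points from x differ by an
    element of the lattice generated by the v_k; both lie in the fundamental
    domain, so this element is 0. *)
Lemma reduce_inj x y km km' :
  parallelepiped v (orbit_point x km) -> parallelepiped v (orbit_point x km') ->
  reduce y km = reduce y km' -> km = km'.
Proof.
move=> /(parallelepipedP hfree) Sx /(parallelepipedP hfree) Sx' E.
pose a k := quot y km k - quot y km' k.
have E1 : km.1 = km'.1 + \sum_k a k * p k.
  have := congr1 fst E; rewrite /reduce /= => e.
  rewrite /a; under eq_bigr do rewrite mulrBl.
  rewrite sumrB; set X := \sum_k _ in e *.
  by set Y := \sum_k _ in e *; lia.
have E2 : km.2 = km'.2 + \sum_k a k *: q k.
  have := congr1 snd E; rewrite /reduce /= => e.
  rewrite /a; under eq_bigr do rewrite scalerBl.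
  by rewrite sumrB addrA addrAC -e subrK.
(* a k is the difference of two numbers in [0, 1) *)
have a0 k : a k = 0.
  have e : orbit_point x km' = orbit_point x km - \sum_k (a k)%:~R *: tnth v k.
    rewrite -orbit_point_lattice E1 E2 !addrK; by case: km' {Sx' E a E1 E2}.
  have := Sx' k; rewrite e linearB /=.
  rewrite coord_lin_comb // => e'; have := Sx k => e''.
  have : (a k)%:~R < (1%:~R : R) by lra.
  have : ((- 1)%:~R : R) < (a k)%:~R by lra.
  by rewrite !ltr_int; lia.
have s1 : \sum_k a k * p k = 0 by apply: big1 => k _; rewrite a0 mul0r.
have s2 : \sum_k a k *: q k = 0 by apply: big1 => k _; rewrite a0 scale0r.
move: E1 E2; rewrite s1 s2 !addr0 => E1 E2.
by rewrite [km]surjective_pairing E1 E2 -surjective_pairing.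
Qed.

(** The k-th coordinate of the orbit point from y differs from the one from x,
    which is in [0, 1), by that of y - x.  Hence its floor is bounded. *)
Lemma reduce_displacement : exists D : nat, forall x y km,
  unit_cube x -> unit_cube y -> parallelepiped v (orbit_point x km) ->
  (`|(reduce y km).1 - km.1| <= D%:Z)%R.
Proof.
pose K k := \sum_i `|coord v k (delta_mx 0 i)|.
(* The coordinate is at most 1 + 2 K k in absolute value; its floor costs 1. *)
pose B := \sum_k (2 * K k + 2) * `|(p k)%:~R|.
exists (Num.trunc B).+1 => x y km Qx Qy /(parallelepipedP hfree) Sx.
rewrite -(ler_int R) intr_norm.
apply: (@le_trans _ _ B); last exact/ltW/truncnS_gt.
rewrite /= addrAC subrr add0r rmorphN normrN rmorph_sum /=.
apply: (le_trans (ler_norm_sum _ _ _)); apply: ler_sum => k _.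
rewrite intrM normrM ler_wpM2r //.
have cx := coord_unit_cube v k Qx; have cy := coord_unit_cube v k Qy.
have fl : (quot y km k)%:~R <= coord v k (orbit_point y km) by exact: ge_floor.
have fu : coord v k (orbit_point y km) < (quot y km k + 1)%:~R.
  exact: floorD1_gt.
have E : coord v k (orbit_point y km) =
    coord v k (orbit_point x km) + coord v k y - coord v k x.
  rewrite /orbit_point -!addrA ![coord v k (_ + (_ + _))]linearD /=; ring.
move: fl fu (Sx k) cx cy; rewrite E intrD !ler_norml -/(K k); lra.
Qed.

(** The reduction with respect to y injects the visits from x into those from y.
    The margin D at both ends keeps the reduced times in [0, n). *)
Lemma visits_compare : exists D : nat, forall x y n,
  unit_cube x -> unit_cube y ->
  (size (visits alpha (parallelepiped v) x D (n - D)) <=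
   size (visits alpha (parallelepiped v) y 0 n))%N.
Proof.
have [D hD] := reduce_displacement; exists D => x y n Qx Qy.
have bS := coord_bounded_parallelepiped v.
pose f (km : nat * 'rV[int]_d) := reduce y (km.1%:Z, km.2).
pose g (km : nat * 'rV[int]_d) := (`|(f km).1|%N, (f km).2).
have fP km : km \in visits alpha (parallelepiped v) x D (n - D) ->
    [/\ parallelepiped v (orbit_point x (km.1%:Z, km.2)),
        0 <= (f km).1 & (f km).1 < n%:Z].
  case: km => k m /(mem_visits _ _ _ _ _ _ bS) [kD Sx].
  have /= := hD x y (k%:Z, m) Qx Qy Sx; rewrite /f /=; split => //; lia.
(* absz loses nothing here, as the reduced times are nonnegative *)
rewrite -(size_map g); apply: uniq_leq_size.
  rewrite map_inj_in_uniq ?visits_uniq // => km km' /fP[Sx f0 _] /fP[Sx' f0' _].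
  move=> e; have e1 : `|(f km).1|%N = `|(f km').1|%N := congr1 fst e.
  have e2 : (f km).2 = (f km').2 := congr1 snd e.
  have ef : f km = f km'.
    rewrite [LHS]surjective_pairing [RHS]surjective_pairing e2.
    by congr (_, _); lia.
  have [e3 e4] := reduce_inj Sx Sx' ef.
  by rewrite [km]surjective_pairing e3 e4 -surjective_pairing.
move=> _ /mapP[km /fP[_ f0 fn] ->]; apply/mem_visits => //; split; first lia.
have := reduce_hits y (km.1%:Z, km.2); rewrite -/(f km) /orbit_point.
by rewrite -{1}(gez0_abs f0).
Qed.

End reduction.

(** * Oscillation and average of the Birkhoff sums *)

Lemma sum_drop_ends {R : realType} (c : nat -> R) (M : R) (D n : nat) :
  (forall k, 0 <= c k <= M) ->
  \sum_(0 <= k < n) c k <= \sum_(D <= k < n - D) c k + (D + D)%:R * M.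
Proof.
move=> cM; have M0 : 0 <= M by case/andP: (cM 0%N); exact: le_trans.
have leM a b : \sum_(a <= k < b) c k <= (b - a)%:R * M.
  rewrite mulr_natl -sumr_const_nat; apply: ler_sum_nat => k _.
  by case/andP: (cM k).
have ge0 a b : 0 <= \sum_(a <= k < b) c k.
  by apply: sumr_ge0 => k _; case/andP: (cM k).
have [nD|Dn] := leqP n (D + D).
  apply: (le_trans (leM 0%N n)); rewrite ler_wpDl // subn0.
  by rewrite ler_wpM2r // ler_nat.
rewrite (@big_cat_nat _ _ _ D) /=; [|lia..].
rewrite (@big_cat_nat _ _ _ (n - D) D) /=; [|lia..].
have := leM 0%N D; have := leM (n - D)%N n.
rewrite natrD (_ : n - (n - D) = D)%N; last lia.
rewrite subn0; lra.
Qed.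

Section birkhoff_sums.
Context {R : realType} (d : nat) (alpha : 'rV[R]_d) (v : d.-tuple 'rV[R]_d).
Hypothesis hfree : free v.
Hypothesis hv : forall k : 'I_d, Zalpha_plus_Zd alpha (tnth v k).
Implicit Types (x y : 'rV[R]_d).

Let S := parallelepiped v.
Let birkhoff n x : R := \sum_(0 <= k < n) chi S (x + k%:R *: alpha).

Lemma birkhoff_oscillation : exists C : R, forall n x y,
  unit_cube x -> unit_cube y -> `|birkhoff n x - birkhoff n y| <= C.
Proof.
have bS := coord_bounded_parallelepiped v.
have [p hp] := choice hv; have [q hq] := choice hp.
have [D hD] := visits_compare hfree hq.
have [M hM] := chi_bounded bS.
exists ((D + D)%:R * M) => n.
suff le x y : unit_cube x -> unit_cube y ->
    birkhoff n x <= birkhoff n y + (D + D)%:R * M.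
  move=> x y Qx Qy; have := le x y Qx Qy; have := le y x Qy Qx.
  by rewrite ler_norml; lra.
move=> Qx Qy; apply: (le_trans (@sum_drop_ends _ _ M D n _)).
  by move=> k; rewrite chi_ge0 hM.
by rewrite lerD2r /birkhoff !sum_chi_visits // ler_nat hD.
Qed.

(** Each of the n terms has average mes S, whatever the shift k alpha. *)
Lemma integral_birkhoff n :
  (\int[lebesgue_rV d]_(x in unit_cube) (birkhoff n x)%:E =
   n%:R%:E * lebesgue_rV d S)%E.
Proof.
have bS := coord_bounded_parallelepiped v.
have mS := measurable_parallelepiped hfree.
under eq_integral do rewrite /birkhoff -sumEFin.
rewrite ge0_integral_sum //; last 3 first.
- exact: measurable_unit_cube.
- by move=> k; apply/measurable_EFinP; exact: measurable_chi_translate.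
- by move=> k x _; rewrite lee_fin chi_ge0.
under eq_bigr do rewrite integral_chi //.
by rewrite big_const_nat subn0 mule_natl iter_addr_0.
Qed.

End birkhoff_sums.

Theorem theorem1 (R : realType) (d : nat) (hd : (1 <= d)%N)
    (alpha : 'rV[R]_d) (halpha : irrational_vec alpha)
    (v : d.-tuple 'rV[R]_d) (hfree : free v)
    (hv : forall k : 'I_d, Zalpha_plus_Zd alpha (tnth v k)) :
  bounded_remainder_set alpha (parallelepiped v).
Proof.
have mS := measurable_parallelepiped hfree.
have bS := coord_bounded_parallelepiped v.
split; [exact: bounded_parallelepiped|exact: measurable_lebesgue_measurable|].
have [C hC] := birkhoff_oscillation hfree hv.
exists C => n _; apply: aeW => x.
have [y Qy [m ->]] := unit_cube_representative x.
under eq_bigr do rewrite addrAC chi_periodic.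
have muS : lebesgue_rV d (parallelepiped v) =
    (fine (mes d (parallelepiped v)))%:E.
  by rewrite mesE // fineK // lebesgue_rV_fin_num.
apply: (dist_average_le (f := fun z => \sum_(0 <= k < n)
  chi (parallelepiped v) (z + k%:R *: alpha))).
- by apply: measurable_sum => k; exact: measurable_chi_translate.
- by move=> z; apply: sumr_ge0 => k _; exact: chi_ge0.
- by rewrite integral_birkhoff // muS -EFinM.
- by move=> z Qz; exact: hC.
Qed.
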